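(* Let $V=V_{-1}\oplus V_0\oplus V_1$ with $V_{-1}=\langle u\rangle$, $V_0=\langle v\rangle$, $V_1=\langle w\rangle$ one-dimensional, equipped with the skew symmetric linear operators $l_n:V^{\otimes n}\to V$ of degree $2-n$ ($n\ge1$) given by constants $a_n,b_n,c_n$ via $$l_n(u\otimes v\otimes w^{\otimes n-2})=a_n u\ (n\ge2),\qquad l_n(u\otimes w^{\otimes n-1})=b_n v\ (n\ge1),\qquad l_n(v\otimes w^{\otimes n-1})=c_n w\ (n\ge1),$$ and $a_1:=0$. Suppose that $V$ with these operators is an $L_\infty$ structure. If there exists $m\in\mathbb N$ such that $b_m\ne0$, then $a_n=c_n=0$ for all $n\geq 1$.
   Context: All vector spaces are graded, over a fixed field of characteristic zero; $|x|$ is the degree of $x$. For a permutation $\sigma$ of a string of homogeneous elements, $\varepsilon(\sigma)$ is the Koszul sign (a factor $(-1)^{pq}$ whenever elements of degrees $p$ and $q$ are commuted) and $\chi(\sigma)=(-1)^{\sigma}\varepsilon(\sigma)$, where $(-1)^\sigma$ is the sign of $\sigma$. A $(p,n-p)$ unshuffle is $\sigma\in S_n$ with $\sigma(1)<\dots<\sigma(p)$ and $\sigma(p+1)<\dots<\sigma(n)$. A linear map $l:V^{\otimes n}\to V$ has degree $k$ if $l(x_1\otimes\dots\otimes x_n)\in V_N$ with $N=k+\sum|x_i|$; it is skew symmetric if $l(x_{\pi(1)}\otimes\dots\otimes x_{\pi(n)})=\chi(\pi)\,l(x_1\otimes\dots\otimes x_n)$ for all $\pi\in S_n$. Given skew symmetric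 maps $l_k$, define $\mathcal J_n:V^{\otimes n}\to V$ by $$\mathcal J_n(x_1\otimes\dots\otimes x_n)=\sum_{p=1}^n(-1)^{p(n-p)}\sum_{\sigma\ (p,n-p)\text{ unshuffle}}\chi(\sigma)\,l_{n-p+1}\big(l_p(x_{\sigma(1)}\otimes\dots\otimes x_{\sigma(p)})\otimes x_{\sigma(p+1)}\otimes\dots\otimes x_{\sigma(n)}\big).$$ $V$ is $L_\infty$ (an $L_\infty$ structure) if the maps $l_k$, $k\ge1$, are skew symmetric, linear, of degree $2-k$, and $\mathcal J_n=0$ for all $n\ge1$. In the claim, $u,v,w$ have degrees $-1,0,1$, and all other graded components of $V$ are zero. The values of $l_n$ on permutations of the listed tensors are determined by skew symmetry; $l_n$ vanishes on all other tensors of basis vectors. *)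

(* Defs.v *)
From HB Require Import structures.
From mathcomp Require Import all_boot all_order all_fingroup all_algebra.

Set Implicit Arguments.
Unset Strict Implicit.
Unset Printing Implicit Defensive.

Import Order.TTheory GRing.Theory Num.Theory.

Local Open Scope ring_scope.

(** Koszul sign of x_1 ... x_n |-> x_(s 1) ... x_(s n), where |x_i| = d i:
    each inversion i < j, s j < s i of s commutes x_(s i) and x_(s j). *)
Definition koszul (F : fieldType) (n : nat) (d : 'I_n -> int) (s : 'S_n) : F :=
  \prod_(ij : 'I_n * 'I_n | (ij.1 < ij.2)%N && (s ij.2 < s ij.1)%N)
     (-1) ^ (d (s ij.1) * d (s ij.2)).

Definition chi (F : fieldType) (n : nat) (d : 'I_n -> int) (s : 'S_n) : F :=
  (-1) ^+ s * koszul F d s.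

Definition unshuffle (n p : nat) (s : 'S_n) : bool :=
  [forall i : 'I_n, forall j : 'I_n,
     (i < j)%N && ((j < p)%N || (p <= i)%N) ==> (s i < s j)%N].

Section Operators.

Variables (F : fieldType) (V : vectType F) (gr : int -> {vspace V}).

Definition homogeneous (n : nat) (d : 'I_n -> int) (x : n.-tuple V) : Prop :=
  forall i, tnth x i \in gr (d i).

Definition subst_at (n : nat) (x : n.-tuple V) (i : 'I_n) (y : V) : n.-tuple V :=
  [tuple if j == i then y else tnth x j | j < n].

(** Linear maps from the n-th tensor power of V to V are represented by
    multilinear maps on n-tuples. *)
Definition multilinear (n : nat) (f : n.-tuple V -> V) : Prop :=
  forall (x : n.-tuple V) (i : 'I_n), linear (fun y => f (subst_at x i y)).

Definition has_degree (n : nat) (k : int) (f : n.-tuple V -> V) : Prop :=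
  forall (d : 'I_n -> int) (x : n.-tuple V), homogeneous d x ->
    f x \in gr (k + \sum_(i < n) d i).

Definition skew_symmetric (n : nat) (f : n.-tuple V -> V) : Prop :=
  forall (d : 'I_n -> int) (x : n.-tuple V) (s : 'S_n), homogeneous d x ->
    f [tuple tnth x (s i) | i < n] = chi F d s *: f x.

Variable l : forall n : nat, n.-tuple V -> V.

(** J_n on homogeneous elements x_1, ..., x_n of degrees d; the ordinal p < n
    stands for the summation index p + 1 in 1..n, and the two tuples below
    list x_(s i) for i <= p + 1 and for i > p + 1 respectively. *)
Definition jacobi (n : nat) (d : 'I_n -> int) (x : n.-tuple V) : V :=
  \sum_(p < n) (-1) ^+ (p.+1 * (n - p.+1)) *:
    \sum_(s : 'S_n | unshuffle p.+1 s) chi F d s *: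
      l [tuple of
           l [tuple tnth x (s (widen_ord (ltn_ord p) i)) | i < p.+1] ::
           [tuple tnth x (s (cast_ord (subnKC (ltn_ord p)) (rshift p.+1 i)))
             | i < n - p.+1]].

(** The value l 0 is unconstrained: only the operations of arity at least 1
    matter. *)
Definition L_infinity : Prop :=
  (forall n, (0 < n)%N ->
     [/\ multilinear (@l n), skew_symmetric (@l n)
       & has_degree (2 - n%:Z) (@l n)]) /\
  (forall n, (0 < n)%N -> forall (d : 'I_n -> int) (x : n.-tuple V),
     homogeneous d x -> jacobi d x = 0).

End Operators.

Definition graded_on_lines (F : fieldType) (V : vectType F)
    (gr : int -> {vspace V}) (u v w : V) : Prop :=
  [/\ gr (-1) = <[u]>%VS, gr 0 = <[v]>%VS & gr 1 = <[w]>%VS] /\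
  [/\ [/\ \dim <[u]> = 1%N, \dim <[v]> = 1%N & \dim <[w]> = 1%N],
      (forall k : int, k \notin [:: -1; 0; 1] -> gr k = 0%VS),
      (<[u]> + <[v]> + <[w]>)%VS = fullv
    & directv (<[u]> + <[v]> + <[w]>)].

Definition given_by_constants (F : fieldType) (V : vectType F) (u v w : V)
    (a b c : nat -> F) (l : forall n : nat, n.-tuple V -> V) : Prop :=
  [/\ forall n, l n.+2 [tuple of u :: v :: nseq n w] = a n.+2 *: u,
      forall n, l n.+1 [tuple of u :: nseq n w] = b n.+1 *: v,
      forall n, l n.+1 [tuple of v :: nseq n w] = c n.+1 *: w
    & forall n (t : n.-tuple V), (0 < n)%N ->
        all [in [:: u; v; w]] t ->
        ~~ perm_eq t (u :: v :: nseq (n - 2) w) ->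
        ~~ perm_eq t (u :: nseq (n - 1) w) ->
        ~~ perm_eq t (v :: nseq (n - 1) w) ->
        l n t = 0].

(* Main.v *)
Require Import Defs.
From mathcomp Require Import all_boot all_order all_fingroup all_algebra.

Import Order.TTheory GRing.Theory Num.Theory.

Local Open Scope ring_scope.

Set Implicit Arguments.
Unset Strict Implicit.
Unset Printing Implicit Defensive.

(** Two of the Jacobi identities suffice: those of [J_n] on [u, w, ..., w] and
    on [u, w, ..., w, u].  All entries of these tensors have odd degree, so
    every sign [chi] is 1 ([chi_all_odd]): for odd elements the Koszul sign of
    a permutation cancels its signature.

    On entries among [u] and [w], an inner operation [l_p] is nonzero only if
    it receives exactly one [u], and its value is then [b_p v].  The outer
    operation is therefore applied to [v] followed by the remaining entries.
    These contain no [u] for the first tensor, which gives [c_q w]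
    ([l_cons_v_w]), and a single [u] for the second, which gives [- a_q u]
    ([l_cons_v_u]), where [q = n - p + 1].  Writing [Y_q] for this vector, both
    identities take the form
      [sum_p (+-1) N_p b_p Y_(n - p + 1) = 0],
    where [N_p] counts the unshuffles that send exactly one [u] to the inner
    operation.

    Let [m] be minimal with [b_m != 0], and suppose that the earlier [Y_q]
    vanish.  In the identity with [n = m + q - 1] the terms with [p < m] vanish
    by the choice of [m] and those with [p > m] by induction, which leaves
    [N_m b_m Y_q = 0].  The tensors are ordered in such a way that the identity
    permutation is counted in [N_m]; so [N_m] is a positive integer, nonzero in
    characteristic zero, and [Y_q = 0] ([outer_value_eq0]).  For the second
    tensor this applies to [q >= 2] only, and [a_1 = 0] by convention. *)

(** * Inversions and the sign chi *)

Definition inversion n (s : 'S_n) (ij : 'I_n * 'I_n) : bool :=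
  (ij.1 < ij.2)%N && (s ij.2 < s ij.1)%N.

(** Permuting the columns of the Vandermonde matrix of [0, 1, ..., n - 1] by [s]
    multiplies its determinant, the product of the [j - i] for [i < j], by the
    signature of [s].  The permuted determinant is the product of the
    [s j - s i], in which exactly the inversions give negative factors. *)
Lemma odd_perm_inversions n (s : 'S_n) :
  odd_perm s = odd #|[pred ij | inversion s ij]|.
Proof.
pose x : 'rV[int]_n := \row_i (i : nat)%:Z.
have Vs : Vandermonde n (\row_i x 0 (s i)) = col_perm s (Vandermonde n x).
  by apply/matrixP=> i j; rewrite !mxE.
have pos i j : (i < j)%N -> Num.sg (j%:Z - i%:Z) = 1.
  by move=> ij; rewrite gtr0_sg // subr_gt0 ltz_nat.
have /(congr1 Num.sg) := congr1 determinant Vs.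
rewrite col_permE det_mulmx det_perm odd_permV !det_Vandermonde !pair_big_dep /=.
rewrite sgrM !(big_morph Num.sg (@sgrM _) (@sgr1 _)).
rewrite [X in _ = X * _]big1 => [|[i j] /= ij]; last by rewrite !mxE pos.
rewrite mul1r (bigID [pred ij | (s ij.2 < s ij.1)%N]) /=.
rewrite [X in _ * X = _]big1 ?mulr1 => [|[i j] /= /andP[ij]]; last first.
  rewrite -leqNgt leq_eqVlt !mxE => /orP[/eqP/ord_inj/perm_inj eq_ij|/pos//].
  by rewrite eq_ij ltnn in ij.
rewrite (eq_bigr (fun=> -1)) => [|[i j] /andP[_ ji]]; last first.
  by rewrite !mxE -opprB sgrN pos.
rewrite prodr_const -signr_odd => /eqP.
by case: (odd_perm s); case: (odd _).
Qed.

(** By this formula only the inversions that involve an element of even degree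
    contribute to [chi]. *)
Lemma chi_inversions (F : fieldType) n (d : 'I_n -> int) (s : 'S_n) :
  chi F d s = \prod_(ij | inversion s ij) - (-1) ^ (d (s ij.1) * d (s ij.2)).
Proof.
rewrite /chi /koszul odd_perm_inversions signr_odd -prodr_const -big_split /=.
by apply: eq_bigr => ij _; rewrite mulN1r.
Qed.

Lemma chi_all_odd (F : fieldType) n (d : 'I_n -> int) (s : 'S_n) :
  (forall i j, (-1) ^ (d i * d j) = -1 :> F) -> chi F d s = 1.
Proof.
by move=> dP; rewrite chi_inversions big1 // => ij _; rewrite dP opprK.
Qed.

(** The even element, initially second, is moved to the front: the inversions
    that involve it reduce to the one with the element initially first. *)
Lemma chi_even_to_front (F : fieldType) n (d : 'I_n.+2 -> int) (s : 'S_n.+2) :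
  (forall i j, (-1) ^ (d i * d j) =
     (if 1%N \in [:: val i; val j] then 1 else -1) :> F) ->
  s ord0 = lift ord0 ord0 -> chi F d s = -1.
Proof.
move=> dP s0; rewrite chi_inversions.
pose o : 'I_n.+2 * 'I_n.+2 := (ord0, s^-1%g ord0).
rewrite (bigD1 o) ?big1 /o /= => [|[i j] /= /andP[/andP[/= ij sji]]|].
- by rewrite dP s0 /= mulr1.
- rewrite dP !inE => ne_o; case: ifP => [|_]; last by rewrite opprK.
  rewrite !(eq_sym 1%N) => /orP[] /eqP s1.
    have i0 : i = ord0 by apply: (@perm_inj _ s); rewrite s0; apply: val_inj.
    have sj0 : s j = ord0.
      by apply: val_inj => /=; move: sji; rewrite s1; case: (s j : nat).
    by rewrite i0 -[j](permK s) sj0 eqxx in ne_o.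
  have j0 : j = ord0 by apply: (@perm_inj _ s); rewrite s0; apply: val_inj.
  by rewrite j0 in ij.
rewrite /inversion /= permKV s0 /= andbT lt0n.
apply/eqP=> e; have {}e : s^-1%g ord0 = ord0 by apply: val_inj.
by have := s0; rewrite -{1}e permKV.
Qed.

(** * Tuples and graded lines *)

Lemma multilinear_consZ (F : fieldType) (V : vectType F) n
    (f : n.+1.-tuple V -> V) (z : F) (y : V) (t : n.-tuple V) :
  multilinear f -> f [tuple of z *: y :: t] = z *: f [tuple of y :: t].
Proof.
move=> /(_ [tuple of y :: t] ord0) f_lin.
have substE y' : subst_at [tuple of y :: t] ord0 y' = [tuple of y' :: t].
  apply: eq_from_tnth => i; rewrite tnth_mktuple.
  case: (unliftP ord0 i) => [j|] -> //=.
  by rewrite !(tnth_nth 0).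
have f0 : f [tuple of 0 :: t] = 0.
  have := f_lin 1 0 0; rewrite !substE !scale1r addr0.
  by move/(congr1 (+%R^~ (- f [tuple of 0 :: t]))); rewrite subrr addrK.
by have := f_lin z y 0; rewrite !substE f0 !addr0.
Qed.

Lemma graded_lines_uniq (F : fieldType) (V : vectType F)
    (gr : int -> {vspace V}) (u v w : V) :
  graded_on_lines gr u v w -> uniq [:: u; v; w].
Proof.
case=> _ [[du dv dw] _ _]; rewrite directv_addE /= => /and3P[+ _ /eqP uvw].
rewrite directv_addE /= => /and3P[_ _ /eqP uv].
have disj (U W : {vspace V}) x : x \in U -> x \in W -> (U :&: W)%VS = 0%VS -> x = 0.
  by move=> xU xW UW; apply/eqP; rewrite -memv0 -UW memv_cap xU.
have nz (x : V) : \dim <[x]> = 1%N -> x != 0 by rewrite dim_vline; case: (x == 0).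
rewrite !inE negb_or !andbT -andbA; apply/and3P; split; apply/eqP=> e.
- have := nz _ du; rewrite (disj _ _ u _ _ uv) ?eqxx ?memv_line //.
  by rewrite e memv_line.
- have := nz _ du; rewrite (disj _ _ u _ _ uvw) ?eqxx ?memv_line //.
    by rewrite (subvP (addvSl _ _)) ?memv_line.
  by rewrite e memv_line.
- have := nz _ dv; rewrite (disj _ _ v _ _ uvw) ?eqxx ?memv_line //.
    by rewrite (subvP (addvSr _ _)) ?memv_line.
  by rewrite e memv_line.
Qed.

Lemma perm_two_letters (T : eqType) (u w : T) (t : seq T) :
  all [in [:: u; w]] t ->
  perm_eq t (nseq (count_mem u t) u ++ nseq (size t - count_mem u t) w).
Proof.
elim: t => //= x t IH /andP[xuw tP]; have {IH} := IH tP.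
have [-> |xu] /= := eqVneq x u; first by rewrite add1n perm_cons subSS.
rewrite add0n subSn ?count_size //=; move: xuw; rewrite !inE (negPf xu) => /eqP->.
move=> tE; rewrite perm_sym -cat1s perm_catCA perm_sym cat1s perm_cons.
exact: tE.
Qed.

(** The arguments of the two operations in a summand of [jacobi] are together a
    rearrangement of [x]. *)
Lemma perm_split_tuple (T : eqType) n (p : 'I_n) (x : n.-tuple T) (s : 'S_n) :
  perm_eq ([tuple tnth x (s (widen_ord (ltn_ord p) i)) | i < p.+1] ++
           [tuple tnth x (s (cast_ord (subnKC (ltn_ord p)) (rshift p.+1 i)))
             | i < n - p.+1]) x.
Proof.
set t1 := mktuple _; set t2 := mktuple _.
apply/tuple_permP; exists s; apply: (@eq_from_nth _ (tnth x p)).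
  by rewrite size_cat !size_tuple subnKC.
rewrite size_cat !size_tuple subnKC // => i i_n.
rewrite -[RHS](tnth_nth _ _ (Ordinal i_n)) tnth_mktuple nth_cat size_tuple.
case: ltnP => [ip|pi].
  rewrite -[LHS](tnth_nth _ _ (Ordinal ip)) tnth_mktuple.
  by congr tnth; congr (s _); apply: val_inj.
have ip : (i - p.+1 < n - p.+1)%N by rewrite ltn_sub2r // (leq_ltn_trans pi).
rewrite -[LHS](tnth_nth _ _ (Ordinal ip)) tnth_mktuple.
by congr tnth; congr (s _); apply: val_inj; rewrite /= subnKC.
Qed.

(** * The operations on tensors of the basis vectors *)

Section ThreeLines.

Variables (F : fieldType) (V : vectType F) (gr : int -> {vspace V}) (u v w : V).
Variables (l : forall n : nat, n.-tuple V -> V) (a b c : nat -> F).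
Hypothesis grV : graded_on_lines gr u v w.
Hypothesis l_abc : given_by_constants u v w a b c l.
Hypothesis LV : L_infinity gr l.

Let uv : u != v.
Proof.
by have := graded_lines_uniq grV; rewrite /= !inE negb_or => /andP[/andP[]].
Qed.

Let uw : u != w.
Proof.
by have := graded_lines_uniq grV; rewrite /= !inE negb_or => /andP[/andP[]].
Qed.

Let vw : v != w.
Proof. by have := graded_lines_uniq grV; rewrite /= !inE negb_or => /and3P[]. Qed.

(** A degree that can be read off the vector itself, so that a degree function
    for a tuple of basis vectors need not be carried along. *)
Definition degree (x : V) : int :=
  if x == u then -1 else if x == v then 0 else 1.

Lemma degree_homogeneous n (x : n.-tuple V) : all [in [:: u; v; w]] x ->
  homogeneous gr (fun i => degree (tnth x i)) x.
Proof.
case: grV => [[gu gv gw] _] /allP xP i; have := xP _ (mem_tnth i x).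
rewrite !inE /degree => /or3P[] /eqP->; rewrite ?eqxx.
- by rewrite gu memv_line.
- by rewrite eq_sym (negPf uv) gv memv_line.
- by rewrite eq_sym (negPf uw) eq_sym (negPf vw) gw memv_line.
Qed.

Lemma degree_odd x y : x \in [:: u; w] -> y \in [:: u; w] ->
  (-1) ^ (degree x * degree y) = -1 :> F.
Proof.
have dw : degree w = 1 by rewrite /degree !(eq_sym w) (negPf uw) (negPf vw).
have du : degree u = -1 by rewrite /degree eqxx.
have E : (-1) ^ (-1) = -1 :> F by rewrite exprN1 invrN invr1.
by rewrite !inE => /orP[]/eqP-> /orP[]/eqP->;
   rewrite ?dw ?du ?mulrNN ?mulr1 ?mul1r ?expr1z ?E.
Qed.

Lemma sub_uw_uvw (t : seq V) : all [in [:: u; w]] t -> all [in [:: u; v; w]] t.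
Proof. by apply: sub_all => x; rewrite !inE => /orP[]->; rewrite ?orbT. Qed.

Lemma chi_uw n (x : n.-tuple V) s : all [in [:: u; w]] x ->
  chi F (fun i => degree (tnth x i)) s = 1.
Proof.
move=> /allP xP; apply: chi_all_odd => i j.
by apply: degree_odd; apply/xP/mem_tnth.
Qed.

Lemma all_uw_nseq (t : seq V) : all [in [:: u; w]] t -> count_mem u t = 0%N ->
  t = nseq (size t) w.
Proof.
move=> tP t0; apply/all_pred1P/allP => x xt /=.
have := allP tP x xt; rewrite !inE => /orP[/eqP xu|//].
by move: xt; rewrite xu -has_pred1 has_count t0.
Qed.

Lemma l_single_u n (t : n.+1.-tuple V) : all [in [:: u; w]] t ->
  count_mem u t = 1%N -> l t = b n.+1 *: v.
Proof.
move=> tP t1; have [_ lb _ _] := l_abc; rewrite -lb.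
have [/(_ n.+1 isT)[_ l_skew _] _] := LV.
have xP : all [in [:: u; w]] [tuple of u :: nseq n w].
  by rewrite /= all_nseq !inE !eqxx !orbT.
have tE : perm_eq t (u :: nseq n w).
  by have := perm_two_letters tP; rewrite t1 size_tuple subn1.
have /tuple_permP[s ts] : perm_eq t [tuple of u :: nseq n w] by [].
have -> : t = [tuple tnth [tuple of u :: nseq n w] (s i) | i < n.+1].
  exact: val_inj.
by rewrite (l_skew _ _ _ (degree_homogeneous (sub_uw_uvw xP))) chi_uw // scale1r.
Qed.

Lemma l_not_single_u n (t : n.-tuple V) : (0 < n)%N -> all [in [:: u; w]] t ->
  count_mem u t != 1%N -> l t = 0.
Proof.
move=> n0 tP t1; have [_ _ _ l0] := l_abc.
have vt : v \notin t.
  by apply/negP=> /(allP tP); rewrite !inE eq_sym (negPf uv) (negPf vw).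
apply: l0 => //; first exact: sub_uw_uvw.
- by apply: contra vt => /perm_mem->; rewrite !inE eqxx orbT.
- apply: contra t1 => /seq.permP->.
  by rewrite /= eqxx count_nseq /= [w == u]eq_sym (negPf uw).
- by apply: contra vt => /perm_mem->; rewrite !inE eqxx.
Qed.

Lemma l_cons_v_w n (t : n.-tuple V) : all [in [:: u; w]] t -> count_mem u t = 0%N ->
  l [tuple of v :: t] = c n.+1 *: w.
Proof.
move=> tP t0; have [_ _ lc _] := l_abc; rewrite -lc; congr l.
by apply: val_inj; rewrite /= {1}(all_uw_nseq tP t0) size_tuple.
Qed.

(** The operation is known on [u, v, w, ..., w]; bringing [v] past [u] to the
    front costs a sign. *)
Lemma l_cons_v_u n (t : n.+1.-tuple V) : all [in [:: u; w]] t ->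
  count_mem u t = 1%N -> l [tuple of v :: t] = - a n.+2 *: u.
Proof.
move=> tP t1; have [la _ _ _] := l_abc; rewrite scaleNr -la -scaleN1r.
have [/(_ n.+2 isT)[_ l_skew _] _] := LV.
set x := [tuple of u :: v :: nseq n w].
have xP : all [in [:: u; v; w]] x.
  by rewrite /= all_nseq !inE !eqxx !orbT.
have /tuple_permP[s ts] : perm_eq (v :: t) x.
  rewrite perm_sym /= -(cat1s v) -[u :: _]cat1s perm_catCA cat1s perm_cons.
  rewrite perm_sym.
  by have := perm_two_letters tP; rewrite t1 size_tuple subn1.
have tE : [tuple of v :: t] = [tuple tnth x (s i) | i < n.+2].
  exact: val_inj.
have xE i : tnth x i = if val i == 0%N then u else if val i == 1%N then v else w.
  case: i => [[|[|i]] iP]; rewrite (tnth_nth 0) //= nth_nseq.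
  by move: (iP); rewrite !ltnS => ->.
have s0 : s ord0 = lift ord0 ord0.
  have := congr1 (fun z => tnth z ord0) tE.
  rewrite /= tnth_mktuple xE (tnth_nth 0) /=.
  case: eqP => [_ /eqP|_]; first by rewrite eq_sym (negPf uv).
  case: eqP => [s1 _|_ /eqP]; first exact: val_inj.
  by rewrite (negPf vw).
rewrite tE (l_skew _ _ _ (degree_homogeneous xP)).
rewrite (@chi_even_to_front _ _ _ _ _ s0) // => i j.
have degv : degree v = 0 by rewrite /degree eq_sym (negPf uv) eqxx.
have xuw k : val k != 1%N -> tnth x k \in [:: u; w].
  by rewrite xE => /negPf->; case: ifP; rewrite !inE eqxx ?orbT.
rewrite !inE !(eq_sym 1%N); case: ifPn => [/orP[]/eqP e|].
- by rewrite xE e degv mul0r.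
- by rewrite [tnth x j]xE e degv mulr0.
- by rewrite negb_or => /andP[ni nj]; apply: degree_odd; apply: xuw.
Qed.

(** * Minimality of b_m and induction *)

(** [Y k] is the value of an operation on [v] followed by [k] entries, of which
    [j] are [u] and the others [w].  The result is drawn from the identities on
    [u, w, ..., w, u, ..., u] with [j] final letters [u]: since they stand at
    the end, the identity permutation leaves exactly one [u] among the first
    [m + 1] entries as soon as [j <= k].  For [k < j] there are too few entries,
    and [Y k = 0] has to be assumed. *)
Lemma outer_value_eq0 (charF0 : [pchar F] =i pred0) j (Y : nat -> V) m :
  (forall n (t : n.-tuple V), all [in [:: u; w]] t -> count_mem u t = j ->
     l [tuple of v :: t] = Y n) ->
  (forall n, (n < j)%N -> Y n = 0) ->
  b m.+1 != 0 -> (forall i, (i < m)%N -> b i.+1 = 0) ->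
  forall n, Y n = 0.
Proof.
move=> lY Y0 bm bmin; elim/ltn_ind => k IH.
have [kj|jk] := ltnP k j; first exact: Y0.
(* Indices are shifted by one from the usual ones: the inner operation of the
   term that survives has arity m + 1, the outer one k + 1. *)
set n := (m + k).+1.
have sz_x : size (u :: nseq (m + (k - j)) w ++ nseq j u) == n.
  by rewrite /= size_cat !size_nseq -addnA subnK.
pose x := Tuple sz_x.
have xP : all [in [:: u; w]] x.
  by rewrite /= all_cat !all_nseq !inE !eqxx !orbT.
have xu : count_mem u x = j.+1.
  by rewrite /= eqxx count_cat !count_nseq /= [w == u]eq_sym (negPf uw) eqxx mul1n.
have [l_lin /(_ n isT _ x (@degree_homogeneous n x (sub_uw_uvw xP)))] := LV.
rewrite /jacobi.
pose t1 (p : 'I_n) (s : 'S_n) :=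
  [tuple tnth x (s (widen_ord (ltn_ord p) i)) | i < p.+1].
pose t2 (p : 'I_n) (s : 'S_n) :=
  [tuple tnth x (s (cast_ord (subnKC (ltn_ord p)) (rshift p.+1 i)))
    | i < n - p.+1].
have t12 p s : perm_eq (t1 p s ++ t2 p s) x by apply: perm_split_tuple.
have t12P p s : all [in [:: u; w]] (t1 p s) /\ all [in [:: u; w]] (t2 p s).
  by apply/andP; rewrite -all_cat (perm_all _ (t12 p s)).
have term p s : l [tuple of l (t1 p s) :: t2 p s] =
    if count_mem u (t1 p s) == 1%N then b p.+1 *: Y (n - p.+1)%N else 0.
  have [t1P t2P] := t12P p s; have [lin _ _] := l_lin (n - p.+1).+1 isT.
  case: ifPn => [/eqP t1u|t1u].
    rewrite (l_single_u t1P t1u) multilinear_consZ // lY //.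
    have := seq.permP (t12 p s) (pred1 u); rewrite count_cat xu t1u add1n.
    by case.
  rewrite (l_not_single_u _ t1P t1u) //.
  by have := multilinear_consZ 0 v (t2 p s) lin; rewrite !scale0r.
have m_n : (m < n)%N by rewrite ltnS leq_addr.
pose o := Ordinal m_n.
rewrite (bigD1 o) //= [X in _ + X]big1 ?addr0 => [|p po]; last first.
  rewrite [X in _ *: X]big1 ?scaler0 // => s _.
  rewrite -/(t1 p s) -/(t2 p s) term; case: ifP => _; rewrite ?scaler0 //.
  move: po; rewrite -val_eqE /= neq_ltn => /orP[pm|mp].
    by rewrite bmin // scale0r scaler0.
  by rewrite IH ?scaler0 // /n subSS ltn_subLR ?ltn_add2r // -ltnS.
pose S := [pred s : 'S_n |
  unshuffle m.+1 s && (count_mem u (t1 o s) == 1%N)].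
rewrite (eq_bigr (fun s => if count_mem u (t1 o s) == 1%N
                           then b m.+1 *: Y k else 0)); last first.
  move=> s _; rewrite chi_uw // scale1r; apply: etrans (term o s) _.
  by rewrite /= subSS addKn.
rewrite -big_mkcondr /= -/S sumr_const -scaler_nat => /eqP.
rewrite !scaler_eq0 signr_eq0 (negPf bm) /=.
(* It remains to see that S is not empty: it contains the identity. *)
rewrite ((pcharf0P F).1 charF0) => /orP[|/eqP//] /eqP/card0_eq/(_ 1%g).
rewrite !inE => /negP[]; apply/andP; split.
  by apply/forallP=> i; apply/forallP=> i'; rewrite !perm1; apply/implyP => /andP[].
have -> : t1 o 1%g = u :: nseq m w :> seq V.
  apply: (@eq_from_nth _ 0); first by rewrite size_tuple /= size_nseq.
  rewrite size_tuple => i im.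
  rewrite -[LHS](tnth_nth 0 _ (Ordinal im)) tnth_mktuple perm1 (tnth_nth 0) /=.
  case: i im => //= i im; rewrite nth_cat !nth_nseq size_nseq.
  by rewrite ltnS in im; rewrite im (leq_trans im) ?leq_addr.
by rewrite /= eqxx count_nseq /= [w == u]eq_sym (negPf uw).
Qed.

End ThreeLines.

Unset Implicit Arguments.

Theorem theorem4p8 (F : fieldType) (charF0 : [pchar F] =i pred0)
    (V : vectType F) (gr : int -> {vspace V}) (u v w : V)
    (grV : graded_on_lines gr u v w)
    (l : forall n : nat, n.-tuple V -> V) (a b c : nat -> F)
    (l_abc : given_by_constants u v w a b c l) (a1 : a 1%N = 0)
    (LV : L_infinity gr l) :
  (exists m : nat, (0 < m)%N /\ b m != 0) ->
  forall n : nat, (0 < n)%N -> a n = 0 /\ c n = 0.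
Proof.
move=> [m' [m'0 bm']].
have /ex_minnP[m bm mmin] : exists m, b m.+1 != 0.
  by exists m'.-1; rewrite prednK.
have bmin i : (i < m)%N -> b i.+1 = 0.
  by move=> im; apply/eqP; apply: contraTT im => /mmin; rewrite -leqNgt.
have [u0 w0] : u != 0 /\ w != 0.
  have [_ [[+ _ +] _ _ _]] := grV; rewrite !dim_vline.
  by case: (u == 0); case: (w == 0).
case=> // n _; split.
  pose Y k := - a k.+1 *: u.
  have /eqP : Y n = 0.
    apply: (outer_value_eq0 grV l_abc LV charF0 (j := 1) _ _ bm bmin).
      case=> [t _|k t]; first by rewrite tuple0.
      exact: (l_cons_v_u grV l_abc LV).
    by case=> // _; rewrite /Y a1 oppr0 scale0r.
  by rewrite scaler_eq0 oppr_eq0 (negPf u0) orbF => /eqP.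
pose Y k := c k.+1 *: w.
have /eqP : Y n = 0.
  apply: (outer_value_eq0 grV l_abc LV charF0 (j := 0) _ _ bm bmin) => // k t.
  exact: (l_cons_v_w l_abc).
by rewrite scaler_eq0 (negPf w0) orbF => /eqP.
Qed.
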